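(* Consider the random walk with multiple function barriers $M[0],\dots,M[N]$ described in the context. Let $t_k$ be the expected time until absorption when starting in $M[k]$, $k=0,1,\dots,N$. Then $t_k$ $(k=0,1,\dots,N)$ is the unique solution of the linear system $$\sum_{j=0}^{N}v_{ij}t_j=\tau_i\qquad (i=0,1,\dots,N),$$ where, writing $\rho=\rho[i,j]$, $n=n[i,j]$, $p=p[i,j]$, $q=q[i,j]$ for the parameters of the edge between $M[i]$ and $M[j]$ (so they depend on the pair $\{i,j\}$), $$v_{ij}=\left[\frac{(1-\rho)\rho^n}{1-\rho^{n+1}}\right]p^*_{[i,j]}\quad (j>i,\ \rho\neq 1),$$ $$v_{ij}=\left[\frac{1-\rho}{1-\rho^{n+1}}\right]p^*_{[i,j]}\quad (j<i,\ \rho\neq 1),$$ $$v_{ij}=\frac{p^*_{[i,j]}}{n+1}\quad (j\neq i,\ \rho=1),$$ $$v_{ii}=-1+\sum_{j<i,\ \rho\neq 1}\left[\frac{\rho(1-\rho^n)}{1-\rho^{n+1}}\right]p^*_{[i,j]}+\sum_{j>i,\ \rho\neq 1}\left[\frac{1-\rho^n}{1-\rho^{n+1}}\right]p^*_{[i,j]}+\sum_{j\neq i,\ \rho=1}\left[\frac{n}{n+1}\right]p^*_{[i,j]},$$ $$\tau_i=-1+\sum_{j<i,\ \rho\neq 1}\left[\frac{n-(n+1)\rho+\rho^{n+1}}{(p-q)(1-\rho^{n+1})}\right]p^*_{[i,j]}+\sum_{j>i,\ \rho\neq 1}\left[\frac{1-(n+1)\rho^n+n\rho^{n+1}}{(p-q)(1-\rho^{n+1})}\right]p^*_{[i,j]}-\sum_{j\neq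 i,\ \rho=1}n\,p^*_{[i,j]}.$$
   Context: Setting. A finite graph has vertices (multiple function barriers) $M[0],\dots,M[N]$. For $i<j$ the edge between $M[i]$ and $M[j]$ carries a finite number $n[i,j]$ of intermediate states, numbered $1,2,\dots,n[i,j]$ in the direction from $M[i]$ to $M[j]$; on this edge position $0$ is $M[i]$ and position $n[i,j]+1$ is $M[j]$. Each edge has parameters $p=p[i,j]$ (one-step forward probability) and $q=q[i,j]$ (one-step backward probability) with $p+q=1$ and $p[i,j]\,q[i,j]>0$, and $\rho[i,j]=p[i,j]/q[i,j]$. Edge parameters belong to the unordered pair: $n[j,i]=n[i,j]$, $p[j,i]=p[i,j]$, $q[j,i]=q[i,j]$, $\rho[j,i]=\rho[i,j]$, ''forward'' always meaning from the smaller-index to the larger-index vertex. The discrete-time walk moves as follows. From intermediate state $k$ of an edge it moves to position $k+1$ of that edge with probability $p$ and to position $k-1$ with probability $q$. From $M[i]$ it moves, with probability $p^*_{[i,j]}$ ($j\ne i$), one step in the direction of $M[j]$ (to position $1$ of the edge if $i<j$, to position $n[i,j]$ if $i>j$), and with probability $p^*_{[i,i]}$ it is absorbed in $M[i]$. Here $\sum_{j=0}^N p^*_{[i,j]}=1$ for every $i=0,\dots,N$. (Pairs not joined by an edge have $p^*_{[i,j]}=p^*_{[j,i]}=0$.) Time convention: each step takes one unit of time, and the act of absorption in a barrier itself counts as one step (so if $p^*_{[i,i]}=1$ then the time until absorption from $M[i]$ is $1$).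
   Formalization: The formal theorem adds the assumption that from every M[i] some barrier M[l] with p*_[l,l]>0 can be reached along positive p*; without it some t_k are infinite and the linear system is singular, so the claim fails. *)

(* Defs.v *)
From HB Require Import structures.
From mathcomp Require Import all_boot all_order all_algebra.
From mathcomp Require Import all_classical all_reals all_analysis.

Set Implicit Arguments.
Unset Strict Implicit.
Unset Printing Implicit Defensive.

Import Order.TTheory GRing.Theory Num.Theory.
Import numFieldNormedType.Exports.

Local Open Scope classical_set_scope.
Local Open Scope ring_scope.

(* [e] is the adjacency relation of the graph.  The parameters [n], [p], [q]
   of an edge are constrained on adjacent pairs only; elsewhere their values
   are irrelevant, since [ps] (the p* of the barriers) vanishes there. *)
Definition graph_params (R : realType) (N : nat) (e : rel 'I_N.+1)
    (n : 'I_N.+1 -> 'I_N.+1 -> nat) (p q ps : 'I_N.+1 -> 'I_N.+1 -> R) : Prop :=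
  [/\ symmetric e,
      irreflexive e,
      forall i j, e i j -> [/\ n j i = n i j, p j i = p i j & q j i = q i j],
      forall i j, e i j -> p i j + q i j = 1 /\ 0 < p i j * q i j &
      [/\ forall i j, 0 <= ps i j,
          forall i, \sum_j ps i j = 1 &
          forall i j, i != j -> ~~ e i j -> ps i j = 0]].

(* When this fails, the walk started at some barrier is almost surely never
   absorbed, its expected absorption time is infinite and the linear system is
   singular. *)
Definition absorption_accessible (R : realType) (N : nat)
    (ps : 'I_N.+1 -> 'I_N.+1 -> R) : Prop :=
  forall i, exists2 l, connect [rel a b | 0 < ps a b] i l & 0 < ps l l.

(* Each edge contributes its intermediate states once, under the pair (i, j)
   with i < j. *)
Definition nmid (N : nat) (e : rel 'I_N.+1) (n : 'I_N.+1 -> 'I_N.+1 -> nat)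
    (ij : 'I_N.+1 * 'I_N.+1) : nat :=
  if e ij.1 ij.2 && (ij.1 < ij.2)%N then n ij.1 ij.2 else 0%N.

(* A state is a barrier M[i], an intermediate state of an edge (i, j)
   ([k : 'I_(nmid e n (i, j))] stands for position k + 1), or the
   state "already absorbed in M[i]".  Keeping the latter distinct from M[i]
   makes the act of absorption count as one step. *)
Definition wstate (N : nat) (e : rel 'I_N.+1)
    (n : 'I_N.+1 -> 'I_N.+1 -> nat) : finType :=
  ('I_N.+1 + {ij : 'I_N.+1 * 'I_N.+1 & 'I_(nmid e n ij)} + 'I_N.+1)%type.

Definition barrier (N : nat) (e : rel 'I_N.+1)
    (n : 'I_N.+1 -> 'I_N.+1 -> nat) (i : 'I_N.+1) : wstate e n := inl (inl i).

Definition absorbed (N : nat) (e : rel 'I_N.+1)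
    (n : 'I_N.+1 -> 'I_N.+1 -> nat) (i : 'I_N.+1) : wstate e n := inr i.

Definition is_absorbed (N : nat) (e : rel 'I_N.+1)
    (n : 'I_N.+1 -> 'I_N.+1 -> nat) (s : wstate e n) : bool :=
  if s is inr _ then true else false.

(* Position [k] of the edge between M[i] and M[j], for i < j: position 0 is
   M[i] and position n[i,j] + 1 is M[j]. *)
Definition position (N : nat) (e : rel 'I_N.+1)
    (n : 'I_N.+1 -> 'I_N.+1 -> nat) (i j : 'I_N.+1) (k : nat) : wstate e n :=
  if k is k'.+1 then
    if insub k' is Some u
    then inl (inr (existT (fun ij => 'I_(nmid e n ij)) (i, j) u))
    else barrier e n j
  else barrier e n i.

Definition first_step (N : nat) (e : rel 'I_N.+1)
    (n : 'I_N.+1 -> 'I_N.+1 -> nat) (i j : 'I_N.+1) : wstate e n :=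
  if (i < j)%N then position e n i j 1 else position e n j i (n i j).

Definition transition (R : realType) (N : nat) (e : rel 'I_N.+1)
    (n : 'I_N.+1 -> 'I_N.+1 -> nat) (p q ps : 'I_N.+1 -> 'I_N.+1 -> R)
    (s s' : wstate e n) : R :=
  match s with
  | inl (inl i) =>
      ps i i * (s' == absorbed e n i)%:R +
      \sum_(j | j != i) ps i j * (s' == first_step e n i j)%:R
  | inl (inr (existT (i, j) k)) =>
      p i j * (s' == position e n i j k.+2)%:R +
      q i j * (s' == position e n i j k)%:R
  | inr i => (s' == absorbed e n i)%:R
  end.

(* [X] is a Markov chain started at [s0] with one-step probabilities [K]; the
   last clause is the Markov property
   P(X_(m+1) = s_(m+1) | X_0 = s_0, .., X_m = s_m) = K s_m s_(m+1),
   multiplied out so as to be meaningful for paths of probability zero. *)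
Definition markov_chain_from (R : realType) (S : finType) (K : S -> S -> R)
    (s0 : S) (d : measure_display) (Omega : measurableType d)
    (P : probability Omega R) (X : nat -> Omega -> S) : Prop :=
  [/\ forall m s, measurable [set w | X m w = s],
      P [set w | X 0%N w = s0] = 1%E &
      forall (s : nat -> S) (m : nat),
        P [set w | forall l, (l <= m.+1)%N -> X l w = s l] =
        (P [set w | forall l, (l <= m)%N -> X l w = s l] *
         (K (s m) (s m.+1))%:E)%E].

(* +oo on the trajectories that are never absorbed *)
Definition absorption_time (R : realType) (N : nat) (e : rel 'I_N.+1)
    (n : 'I_N.+1 -> 'I_N.+1 -> nat) (Omega : Type)
    (X : nat -> Omega -> wstate e n) (w : Omega) : \bar R :=
  ereal_inf [set (m%:R)%:E | m in [set m : nat | is_absorbed (X m w)]].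

Definition expected_absorption_time (R : realType) (N : nat) (e : rel 'I_N.+1)
    (n : 'I_N.+1 -> 'I_N.+1 -> nat) (d : measure_display)
    (Omega : measurableType d) (P : probability Omega R)
    (X : nat -> Omega -> wstate e n) : \bar R :=
  (\int[P]_w absorption_time R X w)%E.

Definition rho (R : realType) (N : nat) (p q : 'I_N.+1 -> 'I_N.+1 -> R)
    (i j : 'I_N.+1) : R := p i j / q i j.

Definition vcoef (R : realType) (N : nat) (n : 'I_N.+1 -> 'I_N.+1 -> nat)
    (p q ps : 'I_N.+1 -> 'I_N.+1 -> R) (i j : 'I_N.+1) : R :=
  let r := rho p q in
  if j == i then
    - 1
    + \sum_(l < N.+1 | (l < i)%N && (r i l != 1))
        (r i l * (1 - r i l ^+ n i l)) / (1 - r i l ^+ (n i l).+1) * ps i l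
    + \sum_(l < N.+1 | (i < l)%N && (r i l != 1))
        (1 - r i l ^+ n i l) / (1 - r i l ^+ (n i l).+1) * ps i l
    + \sum_(l < N.+1 | (l != i) && (r i l == 1))
        (n i l)%:R / (n i l).+1%:R * ps i l
  else if r i j == 1 then ps i j / (n i j).+1%:R
  else if (i < j)%N then
    ((1 - r i j) * r i j ^+ n i j) / (1 - r i j ^+ (n i j).+1) * ps i j
  else (1 - r i j) / (1 - r i j ^+ (n i j).+1) * ps i j.

Definition tau (R : realType) (N : nat) (n : 'I_N.+1 -> 'I_N.+1 -> nat)
    (p q ps : 'I_N.+1 -> 'I_N.+1 -> R) (i : 'I_N.+1) : R :=
  let r := rho p q in
  - 1
  + \sum_(j < N.+1 | (j < i)%N && (r i j != 1))
      ((n i j)%:R - (n i j).+1%:R * r i j + r i j ^+ (n i j).+1)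
      / ((p i j - q i j) * (1 - r i j ^+ (n i j).+1)) * ps i j
  + \sum_(j < N.+1 | (i < j)%N && (r i j != 1))
      (1 - (n i j).+1%:R * r i j ^+ n i j + (n i j)%:R * r i j ^+ (n i j).+1)
      / ((p i j - q i j) * (1 - r i j ^+ (n i j).+1)) * ps i j
  - \sum_(j < N.+1 | (j != i) && (r i j == 1)) (n i j)%:R * ps i j.

Definition solves_system (R : realType) (N : nat)
    (n : 'I_N.+1 -> 'I_N.+1 -> nat) (p q ps : 'I_N.+1 -> 'I_N.+1 -> R)
    (t : 'I_N.+1 -> R) : Prop :=
  forall i, \sum_(j < N.+1) vcoef n p q ps i j * t j = tau n p q ps i.

(* Main.v *)
(** An excursion from M[i] into the edge towards M[j] is a gambler's ruin, for
    which the probability of arriving at M[j] before returning to M[i], and the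
    expected duration, are explicit.  Row i of the system says that
    t_i = 1 + (expectation of t after one such excursion, plus its duration).
    Its matrix is injective by the maximum principle: if a kernel vector had a
    positive maximum, the set where it is attained would be closed under p*
    transitions and would avoid all absorbing barriers, against accessibility.
    The solution extends along the edges, by the ruin formulas, to a function h
    on all states with h = 0 after absorption and h = 1 + K h before; h >= 0 by
    the minimum principle.  If b_m = P(T > m) and H_m = E[h(X_m); T > m - 1],
    then H_(m+1) = H_m - b_m, hence sum_(m < M) b_m = h(s0) - H_M.  The sums are
    bounded, so b_m and with it H_m <= C b_m tend to 0, and E[T] = h(s0). *)

Require Import Defs.
From HB Require Import structures.
From mathcomp Require Import all_boot all_order all_algebra.
From mathcomp Require Import all_classical all_reals all_analysis.
From mathcomp Require Import measurable_realfun ring lra.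

Set Implicit Arguments.
Unset Strict Implicit.
Unset Printing Implicit Defensive.

Import Order.TTheory GRing.Theory Num.Theory.
Import numFieldNormedType.Exports.

Local Open Scope classical_set_scope.
Local Open Scope ring_scope.

(** * Geometric sums and the gambler's ruin on a single edge *)

(** Kept as a sum rather than the quotient of [geoE], so that ratio 1 is no special case and
    positivity is immediate. *)
Definition geo (R : realFieldType) (s : R) (k : nat) : R := \sum_(i < k) s ^+ i.

Lemma geoS (R : realFieldType) (s : R) k : geo s k.+1 = geo s k + s ^+ k.
Proof. by rewrite /geo big_ord_recr. Qed.

Lemma geo0 (R : realFieldType) (s : R) : geo s 0 = 0.
Proof. by rewrite /geo big_ord0. Qed.

Lemma geo1 (R : realFieldType) (s : R) : geo s 1 = 1.
Proof. by rewrite geoS geo0 add0r expr0. Qed.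

Lemma geo_ge0 (R : realFieldType) (s : R) k : 0 < s -> 0 <= geo s k.
Proof. by move=> s0; apply: sumr_ge0 => i _; rewrite exprn_ge0 // ltW. Qed.

Lemma geo_gt0 (R : realFieldType) (s : R) k : 0 < s -> 0 < geo s k.+1.
Proof. by move=> s0; rewrite geoS ltr_wpDl ?exprn_gt0 ?geo_ge0. Qed.

Lemma geo_at1 (R : realFieldType) k : geo (1 : R) k = k%:R.
Proof.
by elim: k => [|k IH]; rewrite ?geo0 // geoS IH expr1n natr1.
Qed.

Lemma geoE (R : realFieldType) (s : R) k : s != 1 ->
  geo s k = (1 - s ^+ k) / (1 - s).
Proof.
move=> s1; have s10 : 1 - s != 0 by rewrite subr_eq0 eq_sym.
elim: k => [|k IH]; first by rewrite geo0 expr0 subrr mul0r.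
by rewrite geoS IH exprS; field.
Qed.

(* Gambler's ruin on positions 0 .. n+1 started from position k: [hit] is the
   probability of reaching n+1 before 0 and [dur] the expected time until
   either is reached. *)
Definition hit (R : realFieldType) (p q : R) (n k : nat) : R :=
  geo (q / p) k / geo (q / p) n.+1.

Definition dur (R : realFieldType) (p q : R) (n k : nat) : R :=
  if p == q then k%:R * (n.+1%:R - k%:R)
  else (k%:R - n.+1%:R * hit p q n k) / (q - p).

(** Expected duration of the ruin plus the expected payoff, worth [a] at position 0 and [b] at
    position n+1. *)
Definition edge_val (R : realFieldType) (p q : R) (n : nat) (a b : R)
    (k : nat) : R :=
  dur p q n k + hit p q n k * b + (1 - hit p q n k) * a.

Lemma hit0 (R : realFieldType) (p q : R) n : hit p q n 0 = 0.
Proof. by rewrite /hit geo0 mul0r. Qed.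

Lemma hit_last (R : realFieldType) (p q : R) n :
  0 < p -> 0 < q -> hit p q n n.+1 = 1.
Proof.
by move=> p0 q0; rewrite /hit divff // gt_eqF // geo_gt0 // divr_gt0.
Qed.

Lemma hit1_gt0 (R : realFieldType) (p q : R) n :
  0 < p -> 0 < q -> 0 < hit p q n 1.
Proof. by move=> p0 q0; rewrite /hit geo1 divr_gt0 ?geo_gt0 ?divr_gt0. Qed.

Lemma hitn_lt1 (R : realFieldType) (p q : R) n :
  0 < p -> 0 < q -> hit p q n n < 1.
Proof.
move=> p0 q0; have s0 : 0 < q / p by rewrite divr_gt0.
by rewrite ltr_pdivrMr ?geo_gt0 // mul1r geoS ltrDl exprn_gt0.
Qed.

Lemma dur0 (R : realFieldType) (p q : R) n : dur p q n 0 = 0.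
Proof. by rewrite /dur hit0 mulr0 subrr !mul0r if_same. Qed.

Lemma dur_last (R : realFieldType) (p q : R) n :
  0 < p -> 0 < q -> dur p q n n.+1 = 0.
Proof.
by move=> p0 q0; rewrite /dur hit_last // mulr1 subrr mul0r mulr0 if_same.
Qed.

Lemma edge_val0 (R : realFieldType) (p q : R) n a b :
  edge_val p q n a b 0 = a.
Proof. by rewrite /edge_val dur0 hit0; ring. Qed.

Lemma edge_val_last (R : realFieldType) (p q : R) n a b :
  0 < p -> 0 < q -> edge_val p q n a b n.+1 = b.
Proof. by move=> p0 q0; rewrite /edge_val dur_last // hit_last //; ring. Qed.

(** The increments of [hit] are proportional to the powers of q/p, so p times one increment is q
    times the preceding one. *)
Lemma hit_step (R : realFieldType) (p q : R) n k :
  0 < p -> 0 < q -> p + q = 1 ->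
  hit p q n k.+1 = p * hit p q n k.+2 + q * hit p q n k.
Proof.
move=> p0 q0 pq; rewrite /hit.
have : geo (q / p) n.+1 != 0 by rewrite gt_eqF ?geo_gt0 ?divr_gt0.
move: (geo _ n.+1) => d d0; rewrite !geoS exprS.
have -> : q = 1 - p by lra.
by field; rewrite d0 gt_eqF.
Qed.

(** For p != q, k / (q - p) is a particular solution and [hit] solves the homogeneous recurrence;
    for p = q = 1/2 the solution is quadratic. *)
Lemma dur_step (R : realFieldType) (p q : R) n k :
  0 < p -> 0 < q -> p + q = 1 ->
  dur p q n k.+1 = 1 + p * dur p q n k.+2 + q * dur p q n k.
Proof.
move=> p0 q0 pq; rewrite /dur; have [e|npq] := eqVneq p q.
  have -> : p = 2^-1 by lra.
  have -> : q = 2^-1 by lra.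
  by rewrite -!natr1; field.
rewrite (hit_step n k p0 q0 pq) -!natr1.
move: (hit _ _ _ k.+2) (hit _ _ _ k) => u v.
have qE : q = 1 - p by lra.
have d0 : q - p != 0 by rewrite subr_eq0 eq_sym.
by move: d0; rewrite qE => d0; field.
Qed.

Lemma edge_val_step (R : realFieldType) (p q : R) n a b k :
  0 < p -> 0 < q -> p + q = 1 ->
  edge_val p q n a b k.+1 =
  1 + p * edge_val p q n a b k.+2 + q * edge_val p q n a b k.
Proof.
move=> p0 q0 pq.
rewrite /edge_val dur_step // (hit_step n k) //.
have -> : q = 1 - p by lra.
by ring.
Qed.

(** * Closed forms at the two end positions, in the ratio p/q *)

Lemma ratio_eq1 (R : realFieldType) (p q : R) : 0 < q -> (p / q == 1) = (p == q).
Proof.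
move=> q0; apply/eqP/eqP => [e|->]; last by rewrite divff // gt_eqF.
by rewrite -[LHS](divfK (lt0r_neq0 q0)) e mul1r.
Qed.

(** [hit] is built on q/p while the system uses p/q; multiplying numerator and denominator by a
    power of r converts one into the other. *)
Lemma hit1E (R : realFieldType) (p q : R) n : 0 < p -> 0 < q ->
  let r := p / q in
  hit p q n 1 = if r == 1 then n.+1%:R^-1
                else (1 - r) * r ^+ n / (1 - r ^+ n.+1).
Proof.
move=> p0 q0 r; have r0 : 0 < r by rewrite divr_gt0.
have sE : q / p = r^-1 by rewrite invf_div.
rewrite /hit sE geo1 mul1r; case: ifPn => [/eqP ->|r1].
  by rewrite invr1 geo_at1.
have rn1 : 1 - r ^+ n.+1 != 0.
  by rewrite subr_eq0 eq_sym pexpr_eq1 // ltW.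
rewrite geoE ?invr_eq1 // exprVn; move: rn1; rewrite exprS => rn1.
have : r ^+ n != 0 by rewrite expf_neq0 // gt_eqF.
move: (r ^+ n) rn1 => y rn1 y0.
by field; rewrite rn1 y0 (gt_eqF r0) subr_eq0 r1 -opprB oppr_eq0 rn1.
Qed.

Lemma hitnE (R : realFieldType) (p q : R) n : 0 < p -> 0 < q ->
  let r := p / q in
  hit p q n n = if r == 1 then n%:R / n.+1%:R
                else r * (1 - r ^+ n) / (1 - r ^+ n.+1).
Proof.
move=> p0 q0 r; have r0 : 0 < r by rewrite divr_gt0.
have sE : q / p = r^-1 by rewrite invf_div.
rewrite /hit sE; case: ifPn => [/eqP ->|r1].
  by rewrite invr1 !geo_at1.
have rn1 : 1 - r ^+ n.+1 != 0.
  by rewrite subr_eq0 eq_sym pexpr_eq1 // ltW.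
rewrite !geoE ?invr_eq1 // !exprVn; move: rn1; rewrite exprS => rn1.
have : r ^+ n != 0 by rewrite expf_neq0 // gt_eqF.
move: (r ^+ n) rn1 => y rn1 y0.
by field; rewrite rn1 y0 (gt_eqF r0) subr_eq0 r1 -opprB oppr_eq0 rn1.
Qed.

Lemma dur1E (R : realFieldType) (p q : R) n : 0 < p -> 0 < q ->
  let r := p / q in
  dur p q n 1 =
  if r == 1 then n%:R
  else - ((1 - n.+1%:R * r ^+ n + n%:R * r ^+ n.+1)
          / ((p - q) * (1 - r ^+ n.+1))).
Proof.
move=> p0 q0 r; have r0 : 0 < r by rewrite divr_gt0.
rewrite /dur hit1E // -/r -ratio_eq1 // -/r; case: (eqVneq r 1) => r1.
  by rewrite -[n.+1%:R]natr1; ring.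
have pq0 : p - q != 0 by move: r1; rewrite ratio_eq1 // subr_eq0.
have : 1 - r ^+ n.+1 != 0 by rewrite subr_eq0 eq_sym pexpr_eq1 // ltW.
rewrite -[n.+1%:R]natr1 exprS; move: (r ^+ n) => y rn1.
by field; rewrite rn1 pq0 -opprB oppr_eq0 pq0.
Qed.

Lemma durnE (R : realFieldType) (p q : R) n : 0 < p -> 0 < q ->
  let r := p / q in
  dur p q n n =
  if r == 1 then n%:R
  else - ((n%:R - n.+1%:R * r + r ^+ n.+1)
          / ((p - q) * (1 - r ^+ n.+1))).
Proof.
move=> p0 q0 r; have r0 : 0 < r by rewrite divr_gt0.
rewrite /dur hitnE // -/r -ratio_eq1 // -/r; case: (eqVneq r 1) => r1.
  by rewrite -[n.+1%:R]natr1; ring.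
have pq0 : p - q != 0 by move: r1; rewrite ratio_eq1 // subr_eq0.
have : 1 - r ^+ n.+1 != 0 by rewrite subr_eq0 eq_sym pexpr_eq1 // ltW.
rewrite -[n.+1%:R]natr1 exprS; move: (r ^+ n) => y rn1.
by field; rewrite rn1 pq0 -opprB oppr_eq0 pq0.
Qed.

(** * The linear system in terms of excursions *)

Lemma edge_pq_gt0 (R : realType) (N : nat) (e : rel 'I_N.+1)
    (n : 'I_N.+1 -> 'I_N.+1 -> nat) (p q ps : 'I_N.+1 -> 'I_N.+1 -> R) i j :
  graph_params e n p q ps -> e i j -> 0 < p i j /\ 0 < q i j.
Proof.
case=> _ _ _ pq _ /pq[pq1 pq0].
have [p0|p0] := ltP 0 (p i j).
  by split=> //; rewrite -(pmulr_rgt0 _ p0).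
have q0 : 0 <= q i j by lra.
by have := mulr_le0_ge0 p0 q0; rewrite leNgt pq0.
Qed.

(* The excursion that starts with a step from M[i] towards M[j]: [arrival] is
   the probability that it ends in M[j] rather than back in M[i], and [delay]
   the expected time it takes after that first step. *)
Definition arrival (R : realType) (N : nat) (n : 'I_N.+1 -> 'I_N.+1 -> nat)
    (p q : 'I_N.+1 -> 'I_N.+1 -> R) (i j : 'I_N.+1) : R :=
  if (i < j)%N then hit (p i j) (q i j) (n i j) 1
  else 1 - hit (p i j) (q i j) (n i j) (n i j).

Definition delay (R : realType) (N : nat) (n : 'I_N.+1 -> 'I_N.+1 -> nat)
    (p q : 'I_N.+1 -> 'I_N.+1 -> R) (i j : 'I_N.+1) : R :=
  dur (p i j) (q i j) (n i j) (if (i < j)%N then 1%N else n i j).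

Lemma arrival_gt0 (R : realType) (N : nat) (n : 'I_N.+1 -> 'I_N.+1 -> nat)
    (p q : 'I_N.+1 -> 'I_N.+1 -> R) i j :
  0 < p i j -> 0 < q i j -> 0 < arrival n p q i j.
Proof.
move=> p0 q0; rewrite /arrival; case: ifP => _; first exact: hit1_gt0.
by rewrite subr_gt0 hitn_lt1.
Qed.

Lemma ps_nonedge (R : realType) (N : nat) (e : rel 'I_N.+1)
    (n : 'I_N.+1 -> 'I_N.+1 -> nat) (p q ps : 'I_N.+1 -> 'I_N.+1 -> R) i j :
  graph_params e n p q ps -> j != i -> ~~ e i j -> ps i j = 0.
Proof. by case=> _ _ _ _ [_ _ h] ji; apply: h; rewrite eq_sym. Qed.

(** Turns complementary probabilities into the single quotients found in [vcoef]. *)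
Lemma one_sub_frac (R : fieldType) (a b d : R) :
  d != 0 -> d - a = b -> 1 - a / d = b / d.
Proof. by move=> d0 <-; field. Qed.

Lemma vcoef_off (R : realType) (N : nat) (e : rel 'I_N.+1)
    (n : 'I_N.+1 -> 'I_N.+1 -> nat) (p q ps : 'I_N.+1 -> 'I_N.+1 -> R) i j :
  graph_params e n p q ps -> j != i ->
  vcoef n p q ps i j = arrival n p q i j * ps i j.
Proof.
move=> hG ji; rewrite /vcoef (negPf ji).
(* Off the graph the edge parameters are arbitrary, but both sides carry the factor [ps i j], which
   is 0 there. *)
have [eij|neij] := boolP (e i j); last first.
  by rewrite (ps_nonedge hG ji neij) !mulr0 mul0r !if_same.
have [p0 q0] := edge_pq_gt0 hG eij.
rewrite /arrival /rho hit1E // hitnE //.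
have [r1|r1] := eqVneq (p i j / q i j) 1.
  rewrite mulrC; case: ifP => // _; congr (_ * _).
  apply/esym; rewrite -[RHS]div1r.
  by apply: one_sub_frac; rewrite ?pnatr_eq0 // -natr1; ring.
case: ifP => // _; congr (_ * _); apply/esym/one_sub_frac.
  by rewrite subr_eq0 eq_sym pexpr_eq1 // ltW // divr_gt0.
by rewrite exprS; ring.
Qed.

(** The three sums range over disjoint sets of indices; each coefficient is the probability that the
    excursion returns to M[i]. *)
Lemma vcoef_diag (R : realType) (N : nat) (e : rel 'I_N.+1)
    (n : 'I_N.+1 -> 'I_N.+1 -> nat) (p q ps : 'I_N.+1 -> 'I_N.+1 -> R) i :
  graph_params e n p q ps ->
  vcoef n p q ps i i =
  -1 + \sum_(j | j != i) (1 - arrival n p q i j) * ps i j.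
Proof.
move=> hG; rewrite /vcoef eqxx -!addrA; congr (_ + _).
(* Extended by 0 to all indices, the sums can be compared term by term. *)
rewrite [X in X + _]big_mkcond [X in _ + (X + _)]big_mkcond.
rewrite [X in _ + (_ + X)]big_mkcond [RHS]big_mkcond /= -!big_split /=.
apply: eq_bigr => j _.
have [->|ji] := eqVneq j i; first by rewrite ltnn !addr0.
have [eij|neij] := boolP (e i j); last first.
  by rewrite (ps_nonedge hG ji neij) !mulr0 !if_same !addr0.
have [p0 q0] := edge_pq_gt0 hG eij.
rewrite /arrival /rho hit1E // hitnE //.
have [r1|r1] := eqVneq (p i j / q i j) 1; rewrite ?andbT ?andbF ?add0r /=.
  case: ifP => _; congr (_ * _); last by rewrite subKr.
  apply/esym; rewrite -[X in 1 - X]div1r.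
  by apply: one_sub_frac; rewrite ?pnatr_eq0 // -natr1; ring.
case: ltngtP => [_|_|/val_inj ij]; last by rewrite ij eqxx in ji.
  by rewrite !addr0 subKr.
rewrite add0r addr0; congr (_ * _); apply/esym/one_sub_frac.
  by rewrite subr_eq0 eq_sym pexpr_eq1 // ltW // divr_gt0.
by rewrite exprS; ring.
Qed.

Lemma tauE (R : realType) (N : nat) (e : rel 'I_N.+1)
    (n : 'I_N.+1 -> 'I_N.+1 -> nat) (p q ps : 'I_N.+1 -> 'I_N.+1 -> R) i :
  graph_params e n p q ps ->
  tau n p q ps i = - 1 - \sum_(j | j != i) delay n p q i j * ps i j.
Proof.
move=> hG; rewrite /tau -!addrA; congr (_ + _).
rewrite -!sumrN [X in X + _]big_mkcond [X in _ + (X + _)]big_mkcond.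
rewrite [X in _ + (_ + X)]big_mkcond [RHS]big_mkcond /= -!big_split /=.
apply: eq_bigr => j _.
have [->|ji] := eqVneq j i; first by rewrite ltnn !addr0.
have [eij|neij] := boolP (e i j); last first.
  by rewrite (ps_nonedge hG ji neij) !mulr0 oppr0 !if_same !addr0.
have [p0 q0] := edge_pq_gt0 hG eij.
rewrite /delay /rho; case: ltngtP => [_|_|/val_inj ij]; last first.
- by rewrite ij eqxx in ji.
- rewrite dur1E //; case: eqVneq => _; rewrite ?add0r ?addr0 //=.
  by rewrite mulNr opprK.
- rewrite durnE //; case: eqVneq => _; rewrite ?add0r ?addr0 //=.
  by rewrite mulNr opprK.
Qed.

(** Row i is thus the first-step equation at M[i]: one step, then the ruin value along the chosen
    edge, with nothing more to pay after absorption. *)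
Lemma system_residual (R : realType) (N : nat) (e : rel 'I_N.+1)
    (n : 'I_N.+1 -> 'I_N.+1 -> nat) (p q ps : 'I_N.+1 -> 'I_N.+1 -> R)
    (x : 'I_N.+1 -> R) i :
  graph_params e n p q ps ->
  \sum_j vcoef n p q ps i j * x j - tau n p q ps i =
  1 - x i + \sum_(j | j != i)
    ps i j * (delay n p q i j + arrival n p q i j * x j
              + (1 - arrival n p q i j) * x i).
Proof.
move=> hG; rewrite (bigD1 i) //= (vcoef_diag _ hG) (tauE _ hG).
under eq_bigr => j ji do rewrite (vcoef_off hG ji).
rewrite [in RHS](eq_bigr (fun j => delay n p q i j * ps i j
    + arrival n p q i j * ps i j * x j
    + (1 - arrival n p q i j) * ps i j * x i)); last by move=> j _; ring.
by rewrite !big_split /= mulrDl mulr_suml; ring.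
Qed.

(** The matrix is minus a weighted graph Laplacian with killing [ps i i], the form to which the
    maximum principle applies. *)
Lemma system_laplace (R : realType) (N : nat) (e : rel 'I_N.+1)
    (n : 'I_N.+1 -> 'I_N.+1 -> nat) (p q ps : 'I_N.+1 -> 'I_N.+1 -> R)
    (y : 'I_N.+1 -> R) i :
  graph_params e n p q ps ->
  \sum_j vcoef n p q ps i j * y j =
  - (ps i i * y i
     + \sum_(j | j != i) ps i j * arrival n p q i j * (y i - y j)).
Proof.
move=> hG; have [_ _ _ _ [_ ps1 _]] := hG.
rewrite (bigD1 i) //= (vcoef_diag _ hG).
under eq_bigr => j ji do rewrite (vcoef_off hG ji).
rewrite [in RHS](eq_bigr (fun j => ps i j * y i
    - (1 - arrival n p q i j) * ps i j * y i
    - arrival n p q i j * ps i j * y j)); last by move=> j _; ring.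
have -> : ps i i = 1 - \sum_(j | j != i) ps i j.
  by rewrite -(ps1 i) [in RHS](bigD1 i) //= addrK.
by rewrite !sumrB -!mulr_suml; ring.
Qed.

(** * Maximum principle, uniqueness and solvability *)

Lemma system_kernel_le0 (R : realType) (N : nat) (e : rel 'I_N.+1)
    (n : 'I_N.+1 -> 'I_N.+1 -> nat) (p q ps : 'I_N.+1 -> 'I_N.+1 -> R)
    (y : 'I_N.+1 -> R) :
  graph_params e n p q ps -> absorption_accessible ps ->
  (forall i, \sum_j vcoef n p q ps i j * y j = 0) -> forall i, y i <= 0.
Proof.
move=> hG hA hy k; have [_ _ _ _ [ps0 _ _]] := hG.
have [m _ ym] : exists2 m, true & forall j, y j <= y m.
  by case: (@arg_maxP _ _ _ k xpredT y isT) => m _ h; exists m => // j; apply: h.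
apply: (le_trans (ym k)); rewrite leNgt; apply/negP => m0.
have arr_gt0 i j : j != i -> 0 < ps i j -> 0 < arrival n p q i j.
  move=> ji pij.
  have [/(edge_pq_gt0 hG)[]|/(ps_nonedge hG ji) pe] := boolP (e i j).
    exact: arrival_gt0.
  by rewrite pe ltxx in pij.
(* At a maximal vertex the killing term and all differences are nonnegative and sum to 0, so each of
   them vanishes. *)
have key i : y i = y m -> ps i i = 0 /\ forall j, 0 < ps i j -> y j = y m.
  move=> yi.
  have term0 j : j != i -> 0 <= ps i j * arrival n p q i j * (y i - y j).
    move=> ji; rewrite mulr_ge0 ?subr_ge0 ?yi //.
    have := ps0 i j; rewrite le_eqVlt => /predU1P[<-|pij]; first by rewrite mul0r.
    by rewrite mulr_ge0 // ltW // arr_gt0.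
  move/eqP: (hy i); rewrite (system_laplace _ _ hG) oppr_eq0.
  rewrite paddr_eq0 ?sumr_ge0 ?mulr_ge0 //; last by rewrite yi ltW.
  case/andP; rewrite yi mulf_eq0 (gt_eqF m0) orbF => /eqP pii.
  rewrite -yi psumr_eq0 // => /allP h; split=> // j pij.
  have [-> //|ji] := eqVneq j i.
  have := h j (mem_index_enum _); rewrite ji /= !mulf_eq0.
  by rewrite (gt_eqF pij) (gt_eqF (arr_gt0 _ _ ji pij)) /= subr_eq0 => /eqP.
(* Maximality propagates along paths of positive p*, so no vertex reached from [m] can absorb. *)
have walk s : forall a, y a = y m -> path [rel a b | 0 < ps a b] a s ->
    ps (last a s) (last a s) = 0.
  elim: s => [|b s IH] a /key [pa nexta] //= /andP[ab].
  exact/IH/nexta.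
by have [l /connectP[s sp ->]] := hA m; rewrite (walk s m) ?ltxx.
Qed.

Lemma system_kernel (R : realType) (N : nat) (e : rel 'I_N.+1)
    (n : 'I_N.+1 -> 'I_N.+1 -> nat) (p q ps : 'I_N.+1 -> 'I_N.+1 -> R)
    (y : 'I_N.+1 -> R) :
  graph_params e n p q ps -> absorption_accessible ps ->
  (forall i, \sum_j vcoef n p q ps i j * y j = 0) -> forall i, y i = 0.
Proof.
move=> hG hA hy i; apply/eqP; rewrite eq_le (system_kernel_le0 hG hA hy) /=.
rewrite -oppr_le0; apply: (system_kernel_le0 (y := fun j => - y j) hG hA) => k.
by under eq_bigr do rewrite mulrN; rewrite sumrN hy oppr0.
Qed.

Lemma system_unique (R : realType) (N : nat) (e : rel 'I_N.+1)
    (n : 'I_N.+1 -> 'I_N.+1 -> nat) (p q ps : 'I_N.+1 -> 'I_N.+1 -> R)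
    (x t : 'I_N.+1 -> R) :
  graph_params e n p q ps -> absorption_accessible ps ->
  solves_system n p q ps x -> solves_system n p q ps t -> x =1 t.
Proof.
move=> hG hA hx ht i; apply/eqP; rewrite -subr_eq0; apply/eqP.
apply: (system_kernel (y := fun j => x j - t j) hG hA) => k.
by under eq_bigr do rewrite mulrBr; rewrite sumrB hx ht subrr.
Qed.

Lemma system_solvable (R : realType) (N : nat) (e : rel 'I_N.+1)
    (n : 'I_N.+1 -> 'I_N.+1 -> nat) (p q ps : 'I_N.+1 -> 'I_N.+1 -> R) :
  graph_params e n p q ps -> absorption_accessible ps ->
  exists t, solves_system n p q ps t.
Proof.
(* The coefficient matrix is transposed, since [v *m A] acts on row vectors. *)
move=> hG hA; pose A : 'M[R]_N.+1 := \matrix_(j, i) vcoef n p q ps i j.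
have mulA (v : 'rV[R]_N.+1) i :
    (v *m A) ord0 i = \sum_j vcoef n p q ps i j * v ord0 j.
  by rewrite mxE; apply: eq_bigr => j _; rewrite mxE mulrC.
have uA : A \in unitmx.
  rewrite -row_free_unit; apply: inj_row_free => v vA0.
  apply/rowP => j; rewrite mxE.
  apply: (system_kernel (y := fun j => v ord0 j) hG hA) => i.
  by rewrite -mulA vA0 mxE.
pose b : 'rV[R]_N.+1 := \row_i tau n p q ps i.
exists (fun j => (b *m invmx A) ord0 j) => i.
by rewrite -mulA mulmxKV // mxE.
Qed.

(** * First hitting times as sums of tail indicators *)

(** The m-th term is 1 exactly when the first index T with [a T] exceeds m, so the series counts 0,
    .., T - 1. *)
Lemma ereal_inf_first_index (R : realType) (a : nat -> bool) :
  ereal_inf [set (m%:R : R)%:E | m in [set m | a m]] =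
  (\sum_(0 <= m <oo) ((`[< forall l, (l < m.+1)%N -> ~~ a l >]%:R : R)%:E))%E.
Proof.
apply/esym/cvg_lim => //.
have [[m am]|na] := pselect (exists m, a m); last first.
  (* Without a hit, the infimum of the empty set is +oo and the M-th partial sum is M. *)
  have -> : [set m | a m] = set0.
    by apply/seteqP; split=> m //= am; case: na; exists m.
  rewrite image_set0 ereal_inf0.
  rewrite (_ : (fun M => _) = (fun M => (M%:R)%:E)).
    by apply/cvgenyP.
  apply/funext => M; rewrite sumEFin; congr _%:E.
  under eq_bigr => m _.
    rewrite asboolT; last by move=> l _; apply/negP => al; apply: na; exists l.
    over.
  by rewrite sumr_const_nat subn0.
have [m0 am0 min0] : exists2 m0, a m0 & forall l, a l -> (m0 <= l)%N.
  by case: (ex_minnP (ex_intro _ m am)) => m0; exists m0.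
have -> : ereal_inf [set (m%:R : R)%:E | m in [set m | a m]] = (m0%:R)%:E.
  apply/eqP; rewrite eq_le; apply/andP; split.
    by apply: ereal_inf_lbound; exists m0.
  by apply: le_ereal_inf_tmp => _ [l /= al <-]; rewrite lee_fin ler_nat min0.
apply: cvg_near_cst; exists m0 => // M /= m0M.
rewrite sumEFin; congr _%:E; rewrite (big_cat_nat (leq0n m0) m0M) //=.
rewrite [X in _ + X]big1_seq ?addr0; last first.
  move=> l /andP[_]; rewrite mem_index_iota => /andP[ml _].
  by rewrite asboolF // => /(_ m0 ml); rewrite am0.
rewrite (eq_big_nat _ _ (F2 := fun=> 1)) ?sumr_const_nat ?subn0 //.
move=> l /andP[_ lm0]; rewrite asboolT // => k kl.
by apply/negP => /min0; rewrite leqNgt (leq_trans kl).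
Qed.

(** * Path events of a Markov chain *)

(** Interpolates between the cylinders of [markov_chain_from] (k = 0) and the event of staying in
    [B] through time m (k = m + 1). *)
Definition chain_event (S Omega : Type) (X : nat -> Omega -> S)
    (B : pred S) (s : nat -> S) (k m : nat) : set Omega :=
  [set w | (forall l, (l < k)%N -> B (X l w)) /\
           (forall l, (k <= l <= m)%N -> X l w = s l)].

Lemma eq_chain_event (S Omega : Type) (X : nat -> Omega -> S)
    (B : pred S) (s s' : nat -> S) (k m : nat) :
  (forall l, (k <= l <= m)%N -> s l = s' l) ->
  chain_event X B s k m = chain_event X B s' k m.
Proof.
move=> ss; apply/seteqP; split=> w [Bw Xw]; split=> // l klm.
  by rewrite -ss // Xw.
by rewrite ss // Xw.
Qed.

Lemma measurable_chain_event (S : finType) d (Omega : measurableType d)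
    (X : nat -> Omega -> S) (B : pred S) s k m :
  (forall m s, measurable [set w | X m w = s]) ->
  measurable (chain_event X B s k m).
Proof.
move=> mX.
have mB l : measurable [set w | B (X l w)].
  rewrite (_ : [set w | _] = \bigcup_(x in [set x | B x]) [set w | X l w = x]).
    by apply: fin_bigcup_measurable => //; exact: finite_finset.
  by apply/seteqP; split=> w /= => [|[x /= Bx ->]]//; exists (X l w).
rewrite (_ : chain_event _ _ _ _ _ =
  (\bigcap_(l in [set l | (l < k)%N]) [set w | B (X l w)]) `&`
  (\bigcap_(l in [set l | (k <= l <= m)%N]) [set w | X l w = s l])).
  by apply: measurableI; apply: bigcap_measurableType => l _.
by apply/seteqP; split=> w.
Qed.

Lemma probability_fin_split (R : realType) d (Omega : measurableType d)
    (P : probability Omega R) (S : finType) (Y : Omega -> S) (B : pred S)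
    (A : set Omega) :
  (forall s, measurable (A `&` [set w | Y w = s])) ->
  P (A `&` [set w | B (Y w)]) =
  (\sum_(s | B s) P (A `&` [set w | Y w = s]))%E.
Proof.
move=> mA.
rewrite (_ : _ `&` _ = \bigcup_(s in [set s | B s]) (A `&` [set w | Y w = s])).
  rewrite measure_fin_bigcup //; last 2 first.
  - exact: finite_finset.
  - by move=> s t _ _ [w [[_ /= <-] [_ /= <-]]].
  rewrite [RHS]bigfs ?index_enum_uniq // => s _.
  by rewrite mem_index_enum.
apply/seteqP; split=> w /=; first by move=> [Aw BY]; exists (Y w).
by move=> [s /= Bs [Aw ->]].
Qed.

(** Summing over the value at time k trades a membership constraint for a prescribed value, which
    allows induction on k down to cylinders. *)
Lemma chain_event_split (R : realType) (S : finType) d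
    (Omega : measurableType d) (P : probability Omega R)
    (X : nat -> Omega -> S) (B : pred S) s k m :
  (forall m s, measurable [set w | X m w = s]) -> (k <= m)%N ->
  P (chain_event X B s k.+1 m) =
  (\sum_(x | B x)
     P (chain_event X B (fun l => if l == k then x else s l) k m))%E.
Proof.
move=> mX km.
(* [A] leaves the value at time k free. *)
pose A := [set w | (forall l, (l < k)%N -> B (X l w)) /\
                   (forall l, (k.+1 <= l <= m)%N -> X l w = s l)].
have AE x : chain_event X B (fun l => if l == k then x else s l) k m =
            A `&` [set w | X k w = x].
  apply/seteqP; split=> w.
    move=> [Bw Xw]; split; last by have := Xw k; rewrite leqnn km eqxx; apply.
    split=> // l /andP[kl lm]; have := Xw l.
    by rewrite (ltnW kl) lm (gtn_eqF kl); apply.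
  move=> [[Bw Xw] /= Xk]; split=> // l /andP[]; rewrite leq_eqVlt.
  case/predU1P => [<- _|kl lm]; first by rewrite eqxx.
  by rewrite (gtn_eqF kl) Xw // kl.
under eq_bigr do rewrite AE.
rewrite -probability_fin_split; last first.
  by move=> x; rewrite -AE; exact: measurable_chain_event.
congr (P _); apply/seteqP; split=> w.
  by move=> [Bw Xw]; split; [split=> // l lk; apply: Bw; rewrite ltnW|apply: Bw].
move=> [[Bw Xw] Bk]; split=> // l; rewrite ltnS leq_eqVlt.
by case/predU1P => [->|/Bw].
Qed.

(** The Markov property survives finite disjoint unions of cylinders with the same state at time m;
    k <= m keeps that state prescribed. *)
Lemma chain_event_step (R : realType) (S : finType) (K : S -> S -> R) s0 d
    (Omega : measurableType d) (P : probability Omega R)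
    (X : nat -> Omega -> S) (B : pred S) s k m :
  markov_chain_from K s0 P X -> (k <= m)%N ->
  P (chain_event X B s k m.+1) =
  (P (chain_event X B s k m) * (K (s m) (s m.+1))%:E)%E.
Proof.
move=> [mX _ mk]; elim: k s => [|k IH] s km.
  have E j : chain_event X B s 0 j =
             [set w | forall l, (l <= j)%N -> X l w = s l].
    by apply/seteqP; split=> [w []|w Xw] //; split.
  by rewrite !E mk.
rewrite !chain_event_split ?(ltnW km) ?(leqW (ltnW km)) //.
rewrite ge0_sume_distrl; last by move=> *; exact: measure_ge0.
apply: eq_bigr => x _; rewrite IH ?(ltnW km) //.
(* Overriding [s] at time k changes neither [s m] nor [s m.+1], because k < m. *)
by rewrite (gtn_eqF km) (gtn_eqF (leqW km)).
Qed.

(** * Expected exit time of a finite chain *)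

Lemma expected_exit_time (R : realType) (S : finType) (K : S -> S -> R) s0 d
    (Omega : measurableType d) (P : probability Omega R)
    (X : nat -> Omega -> S) (A : pred S) (h : S -> R) :
  markov_chain_from K s0 P X ->
  (forall s, 0 <= h s) -> (forall s, A s -> h s = 0) ->
  (forall s, ~~ A s -> h s = 1 + \sum_s' K s s' * h s') ->
  (\int[P]_w ereal_inf [set (m%:R : R)%:E | m in [set m | A (X m w)]])%E
  = (h s0)%:E.
Proof.
move=> hX h_ge0 hA hK; have [mX X0 _] := hX.
pose B := [pred s | ~~ A s].
(* With T the exit time and x outside [A], [a m x] is P(X_m = x, T > m). Hence [b m] is P(T > m),
   and [H m] is E[h(X_m); T > m], where T > m - 1 gives the same value as [h] vanishes on [A]. *)
pose a m x := fine (P (chain_event X B (fun=> x) m m)).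
pose b m := \sum_(x | B x) a m x.
pose H m := \sum_(x | B x) a m x * h x.
have mE s k m : measurable (chain_event X B s k m).
  exact: measurable_chain_event.
have aE m x : P (chain_event X B (fun=> x) m m) = (a m x)%:E.
  by rewrite fineK // fin_num_measure.
have a_ge0 m x : 0 <= a m x by rewrite fine_ge0.
have b_ge0 m : 0 <= b m by exact: sumr_ge0.
have H_ge0 m : 0 <= H m by apply: sumr_ge0 => x _; rewrite mulr_ge0.
have H0 : H 0 = h s0.
  have ev0 x : chain_event X B (fun=> x) 0 0 = [set w | X 0 w = x].
    by apply/seteqP; split=> w; [case=> _ /(_ 0); apply|split=> // -[]].
  have as0 : a 0 s0 = 1 by rewrite /a ev0 X0.
  have ax x : x != s0 -> a 0 x = 0.
    move=> xs0; apply/eqP; rewrite eq_le a_ge0 andbT -lee_fin -aE ev0.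
    have /(le_trans _) : (P (~` [set w | X 0%N w = s0]) <= 0%:E)%E.
      by rewrite probability_setC // X0 subee.
    apply; apply: le_measure; rewrite ?inE //; first exact: measurableC.
    by move=> w /= ->; apply/eqP.
  rewrite /H big_mkcond (bigD1 s0) //= big1 ?addr0.
    (* If [s0] lies in [A] its term is missing from the sum, but then [h s0] is 0. *)
    by rewrite as0 mul1r; case: ifPn => // /negPn /hA.
  by move=> x /ax ->; rewrite mul0r if_same.
have aS m y : a m.+1 y = \sum_(x | B x) a m x * K x y.
  apply/EFin_inj; rewrite -aE chain_event_split // -sumEFin.
  apply: eq_bigr => x _; rewrite (chain_event_step _ _ hX) //= eqxx.
  rewrite gtn_eqF // EFinM -aE; congr (P _ * _)%E.
  by apply: eq_chain_event => l /andP[ml lm]; rewrite eqn_leq lm ml.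
(* The path argument [s0] is a dummy: no time l satisfies m + 1 <= l <= m. *)
have bP m : P (chain_event X B (fun=> s0) m.+1 m) = (b m)%:E.
  rewrite chain_event_split // -sumEFin; apply: eq_bigr => x _; rewrite -aE.
  congr (P _); apply: eq_chain_event => l.
  by rewrite -eqn_leq eq_sym => ->.
have HS m : H m.+1 = H m - b m.
  rewrite /H /b -sumrB (eq_bigr (fun y =>
    \sum_(x | B x) a m x * (K x y * h y))); last first.
    by move=> y _; rewrite aS mulr_suml; apply: eq_bigr => x _; rewrite mulrA.
  rewrite exchange_big /=; apply: eq_bigr => x Bx.
  rewrite -mulr_sumr [in RHS](hK _ Bx) mulrDr mulr1 addrC addKr.
  (* States of [A] contribute 0 to the full sum given by [hK], which leaves the sum over [B]. *)
  congr (_ * _); rewrite [RHS](bigID B) /= [X in _ + X]big1 ?addr0 //.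
  by move=> y; rewrite negbK => /hA ->; rewrite mulr0.
have bE M : series b M = h s0 - H M.
  elim: M => [|M IH]; first by rewrite /series /= big_geq // H0 subrr.
  by rewrite seriesSr IH HS; ring.
(* As [S] is finite and [h] nonnegative, the sum of all values of [h] bounds each of them. *)
have H_le m : H m <= (\sum_x h x) * b m.
  rewrite mulr_sumr; apply: ler_sum => x _; rewrite mulrC ler_wpM2r //.
  by rewrite (bigD1 x) //= lerDl sumr_ge0.
have b_cvg : b @ \oo --> 0.
  apply: cvg_series_cvg_0; apply: nondecreasing_is_cvgn.
    by apply/nondecreasing_seqP => m; rewrite seriesSr lerDl.
  by exists (h s0) => _ [M _ <-]; rewrite bE gerBl.
have H_cvg : H @ \oo --> 0.
  apply: (@squeeze_cvgr _ _ _ _ (fun=> 0) (fun m => (\sum_x h x) * b m)).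
  - by near=> m; rewrite H_ge0 H_le.
  - exact: cvg_cst.
  - by rewrite -[X in _ --> X](mulr0 (\sum_x h x)); apply: cvgMr.
have sb_cvg : series b @ \oo --> h s0.
  rewrite (_ : series b = fun M => h s0 - H M); last exact/funext.
  by rewrite -[X in _ --> X]subr0; apply: cvgB => //; exact: cvg_cst.
(* [T m] is the indicator of the exit time exceeding m; monotone convergence then integrates the
   series term by term. *)
pose T m w := \1_(chain_event X B (fun=> s0) m.+1 m) w : R.
have TE w : ereal_inf [set (m%:R : R)%:E | m in [set m | A (X m w)]] =
    (\sum_(0 <= m <oo) (T m w)%:E)%E.
  rewrite ereal_inf_first_index; apply: eq_eseriesr => m _.
  rewrite /T indicE; congr (_%:R%:E); congr nat_of_bool.
  apply/asboolP/idP => [hw|]; last by rewrite inE => -[].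
  by rewrite inE; split=> // l /andP[ml lm]; move: ml; rewrite ltnNge lm.
under eq_integral do rewrite TE.
rewrite integral_nneseries //; last 2 first.
- by move=> m; exact/measurable_EFinP/measurable_indic.
- by move=> m w _; rewrite lee_fin.
rewrite (eq_eseriesr (g := fun m => (b m)%:E)); last first.
  by move=> m _; rewrite integral_indic // setIT; exact: bP.
apply/cvg_lim => //; apply: cvg_EFin; first by apply: nearW => M; rewrite sumEFin.
by rewrite (_ : _ \o _ = series b) //; apply/funext => M; rewrite /= sumEFin.
Unshelve. all: by end_near. Qed.

(** A [K]-average of [h] is at least its minimum, so at a minimum outside [A] the equation would
    give h >= 1 + h. The minimum is therefore attained in [A], where [h] is 0. *)
Lemma exit_time_ge0 (R : realType) (S : finType) (K : S -> S -> R) (A : pred S)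
    (h : S -> R) :
  (forall s s', 0 <= K s s') -> (forall s, \sum_s' K s s' = 1) ->
  (forall s, A s -> h s = 0) ->
  (forall s, ~~ A s -> h s = 1 + \sum_s' K s s' * h s') ->
  forall s, 0 <= h s.
Proof.
move=> K0 K1 hA hK s.
have [m _ hm] : exists2 m, true & forall s', h m <= h s'.
  by case: (@arg_minP _ _ _ s xpredT h isT) => m _ hm; exists m => // s'; apply: hm.
apply: (le_trans _ (hm s)); have [/hA -> //|/hK hmE] := boolP (A m).
suff : 1 + h m <= h m by rewrite gerDr ler10.
rewrite {2}hmE lerD2l -[leLHS]mul1r -(K1 m) mulr_suml.
by apply: ler_sum => s' _; rewrite ler_wpM2l.
Qed.

(** * The transition kernel of the walk *)

Lemma sum_eq_pick (R : pzRingType) (S : finType) (f : S -> R) (a : S) :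
  \sum_s (s == a)%:R * f s = f a.
Proof.
rewrite (bigD1 a) //= eqxx mul1r big1 ?addr0 // => s /negPf ->.
by rewrite mul0r.
Qed.

(** Used with [f] constant 1 for the total mass, and with the extended solution for its first-step
    equation. *)
Lemma transition_sum (R : realType) (N : nat) (e : rel 'I_N.+1)
    (n : 'I_N.+1 -> 'I_N.+1 -> nat) (p q ps : 'I_N.+1 -> 'I_N.+1 -> R)
    (f : wstate e n -> R) (s : wstate e n) :
  \sum_s' transition p q ps s s' * f s' =
  match s with
  | inl (inl i) => ps i i * f (absorbed e n i) +
                   \sum_(j | j != i) ps i j * f (first_step e n i j)
  | inl (inr (existT (i, j) k)) => p i j * f (position e n i j k.+2) +
                                   q i j * f (position e n i j k)
  | inr i => f (absorbed e n i)
  end.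
Proof.
case: s => [[i|[[i j] k]]|i] /=; last exact: sum_eq_pick.
- under eq_bigr do rewrite mulrDl mulr_suml -mulrA.
  rewrite big_split /= -mulr_sumr sum_eq_pick exchange_big /=; congr (_ + _).
  apply: eq_bigr => j _; under eq_bigr do rewrite -mulrA.
  by rewrite -mulr_sumr sum_eq_pick.
- under eq_bigr do rewrite mulrDl -!mulrA.
  by rewrite big_split /= -!mulr_sumr !sum_eq_pick.
Qed.

(** For any other pair the type of [k] is empty, so [k] itself is the certificate. *)
Lemma nmid_edge (N : nat) (e : rel 'I_N.+1) (n : 'I_N.+1 -> 'I_N.+1 -> nat)
    (ij : 'I_N.+1 * 'I_N.+1) (k : 'I_(nmid e n ij)) :
  e ij.1 ij.2 /\ (ij.1 < ij.2)%N.
Proof.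
by apply/andP; case: k => k; rewrite /nmid; case: ifP.
Qed.

Lemma transition_ge0 (R : realType) (N : nat) (e : rel 'I_N.+1)
    (n : 'I_N.+1 -> 'I_N.+1 -> nat) (p q ps : 'I_N.+1 -> 'I_N.+1 -> R) :
  graph_params e n p q ps ->
  forall s s' : wstate e n, 0 <= transition p q ps s s'.
Proof.
move=> hG; have [_ _ _ _ [ps0 _ _]] := hG.
case=> [[i|[[i j] k]]|i] s' //=.
  by rewrite addr_ge0 ?sumr_ge0 // => *; rewrite mulr_ge0.
have [eij _] := nmid_edge k; have [p0 q0] := edge_pq_gt0 hG eij.
by rewrite addr_ge0 // mulr_ge0 // ltW.
Qed.

Lemma transition_sum1 (R : realType) (N : nat) (e : rel 'I_N.+1)
    (n : 'I_N.+1 -> 'I_N.+1 -> nat) (p q ps : 'I_N.+1 -> 'I_N.+1 -> R) :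
  graph_params e n p q ps ->
  forall s : wstate e n, \sum_s' transition p q ps s s' = 1.
Proof.
move=> hG s; have [_ _ _ pq [_ ps1 _]] := hG.
under eq_bigr do rewrite -[transition _ _ _ _ _]mulr1.
rewrite (transition_sum p q ps (fun=> 1)).
case: s => [[i|[[i j] k]]|i] //; rewrite ?mulr1.
  by under eq_bigr do rewrite mulr1; rewrite -(ps1 i) [RHS](bigD1 i).
by have [/pq[]] := nmid_edge k.
Qed.

(** * Extension of the solution along the edges *)

Definition edge_extension (R : realType) (N : nat) (e : rel 'I_N.+1)
    (n : 'I_N.+1 -> 'I_N.+1 -> nat) (p q : 'I_N.+1 -> 'I_N.+1 -> R)
    (x : 'I_N.+1 -> R) (s : wstate e n) : R :=
  match s with
  | inl (inl i) => x i
  | inl (inr (existT (i, j) k)) =>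
      edge_val (p i j) (q i j) (n i j) (x i) (x j) k.+1
  | inr _ => 0
  end.

Lemma edge_extension_position (R : realType) (N : nat) (e : rel 'I_N.+1)
    (n : 'I_N.+1 -> 'I_N.+1 -> nat) (p q ps : 'I_N.+1 -> 'I_N.+1 -> R)
    (x : 'I_N.+1 -> R) i j k :
  graph_params e n p q ps -> e i j -> (i < j)%N -> (k <= (n i j).+1)%N ->
  edge_extension p q x (position e n i j k) =
  edge_val (p i j) (q i j) (n i j) (x i) (x j) k.
Proof.
move=> hG eij ij; have [p0 q0] := edge_pq_gt0 hG eij.
case: k => [|k] kn; first by rewrite /= edge_val0.
rewrite /position; case: insubP => [u _ <- //|]; rewrite -leqNgt.
rewrite /nmid /= eij ij /= => nk.
(* [insub] fails only at position n + 1, which is the barrier M[j]. *)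
have -> : k = n i j by apply/eqP; rewrite eqn_leq nk -ltnS kn.
by rewrite edge_val_last.
Qed.

Lemma edge_extension_first_step (R : realType) (N : nat) (e : rel 'I_N.+1)
    (n : 'I_N.+1 -> 'I_N.+1 -> nat) (p q ps : 'I_N.+1 -> 'I_N.+1 -> R)
    (x : 'I_N.+1 -> R) i j :
  graph_params e n p q ps -> e i j ->
  edge_extension p q x (first_step e n i j) =
  delay n p q i j + arrival n p q i j * x j + (1 - arrival n p q i j) * x i.
Proof.
move=> hG eij; have [es ei epar _ _] := hG.
rewrite /first_step /delay /arrival; case: ltngtP => [ij|ji|/val_inj ij].
- by rewrite (edge_extension_position _ hG).
(* The edge is stored under (j, i), so the walk starts at its far end; the symmetry of the
   parameters restores the pair (i, j). *)
- have eji : e j i by rewrite es.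
  have [nji pji qji] := epar _ _ eij.
  rewrite (edge_extension_position _ hG) // ?nji // pji qji.
  by rewrite /edge_val; ring.
- by move: eij; rewrite ij ei.
Qed.

(** At a barrier this is a row of the system, at an intermediate state the ruin recurrence. *)
Lemma edge_extension_step (R : realType) (N : nat) (e : rel 'I_N.+1)
    (n : 'I_N.+1 -> 'I_N.+1 -> nat) (p q ps : 'I_N.+1 -> 'I_N.+1 -> R)
    (t : 'I_N.+1 -> R) :
  graph_params e n p q ps -> solves_system n p q ps t ->
  forall s : wstate e n, ~~ is_absorbed s ->
  edge_extension p q t s =
  1 + \sum_s' transition p q ps s s' * edge_extension p q t s'.
Proof.
move=> hG ht s; rewrite transition_sum; have [_ _ _ pq _] := hG.
case: s => [[i|[[i j] k]]|i] //= _.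
  have := system_residual t i hG; rewrite (ht i) subrr mulr0 add0r.
  rewrite [in X in _ -> _ = _ + X](eq_bigr (fun j => ps i j *
    (delay n p q i j + arrival n p q i j * t j
     + (1 - arrival n p q i j) * t i))); last first.
    move=> j ji; have [eij|neij] := boolP (e i j).
      by rewrite (edge_extension_first_step _ hG).
    by rewrite (ps_nonedge hG ji neij) !mul0r.
  by move: (\sum_(_ | _) _) => S S0; lra.
have /= [eij ij] := nmid_edge k; have [p0 q0] := edge_pq_gt0 hG eij.
have kn : (k < n i j)%N by have := ltn_ord k; rewrite {2}/nmid /= eij ij.
rewrite -/(position e n i j k.+2).
rewrite !(edge_extension_position _ hG) ?(ltnW (leqW kn)) //.
by rewrite addrA; apply: edge_val_step => //; case: (pq _ _ eij).
Qed.

Theorem theorem4 (R : realType) (N : nat) (e : rel 'I_N.+1)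
    (n : 'I_N.+1 -> 'I_N.+1 -> nat) (p q ps : 'I_N.+1 -> 'I_N.+1 -> R)
    (hG : graph_params e n p q ps)
    (hA : absorption_accessible ps)
    (d : 'I_N.+1 -> measure_display)
    (Omega : forall k : 'I_N.+1, measurableType (d k))
    (P : forall k : 'I_N.+1, probability (Omega k) R)
    (X : forall k : 'I_N.+1, nat -> Omega k -> wstate e n)
    (hX : forall k : 'I_N.+1,
        markov_chain_from (transition p q ps) (barrier e n k) (P k) (X k)) :
  exists t : 'I_N.+1 -> R,
    [/\ forall k, expected_absorption_time (P k) (X k) = (t k)%:E,
        solves_system n p q ps t &
        forall x : 'I_N.+1 -> R, solves_system n p q ps x -> x =1 t].
Proof.
(* The witness comes from linear algebra; its extension to all states is then identified with the
   expected exit time of any chain realising the walk. *)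
have [t ht] := system_solvable hG hA; exists t; split=> // [k|x hx]; last first.
  exact: system_unique hG hA hx ht.
have h0 s : is_absorbed s -> @edge_extension R N e n p q t s = 0 by case: s.
have hK := edge_extension_step hG ht.
exact: expected_exit_time (hX k)
  (exit_time_ge0 (transition_ge0 hG) (transition_sum1 hG) h0 hK) h0 hK.
Qed.
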